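(* Let $e_t=(u,t)\in E$ be any edge of $G$ entering the vertex $t$. Let $P^*=\{e_1,\dots,e_t\}$ (edges listed in order) be a walk from $s$ to $t$ with last edge $e_t$, of length (number of edges) $|P^*|\le p$, which is of least cost among the walks from $s$ to $t$ with last edge $e_t$. Then after $p$ update iterations of the minimal-angle Bellman-Ford algorithm, $$D[e_t]=c(e_1)+\sum_{i=2}^{t}\Big(c(e_i)+\alpha\big(\sphericalangle(e_{i-1},e_i)\big)\Big)=:c(P^* ),$$ and $c(P^* )$ is the cost of the shortest minimal-angle walk (i.e. the least cost, with respect to edge costs plus angle costs, of a walk from $s$ with last edge $e_t$).
   Context: $G=(V,E)$ is a finite directed graph whose vertices are points of the plane (raster cells), so each edge has a direction vector. For consecutive edges $f=(w,u)$ and $e=(u,v)$, $\sphericalangle(f,e)\in[0,180]$ is the angle in degrees between their direction vectors (so $0$ means going straight on). $s\in V$ is the source. There is an edge cost function $c:E\to\mathbb{R}$ and an angle cost function $\alpha:[0,180]\to\mathbb{R}^+$. The cost of a walk with edges $e_1,\dots,e_r$ is $c(e_1)+\sum_{i=2}^{r}\big(c(e_i)+\alpha(\sphericalangle(e_{i-1},e_i))\big)$. A walk may repeat vertices and edges. The integer $p\geq 1$ is an upper bound on the number of edges of the sought shortest walk. Minimal-angle Bellman-Ford algorithm: Initialize $D[e]=\infty$ for all $e\in E$, then set $D[e]=c(e)$ for every edge $e=(s,\cdot)$ leaving $s$; initialize predecessors $T[e]=e$. Then perform $p$ iterations; in each iteration go through all edges $e=(u,v)\in E$ in a fixed order and update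 $$D[e]\leftarrow \min\Big\{D[e],\ \min_{f\in E,\ f=(\cdot,u)} D[f]+c(e)+\alpha(\sphericalangle(f,e))\Big\},$$ setting $T[e]$ to a minimizing edge $f$ whenever the value of $D[e]$ decreases. *)

(* Defs.v *)
From mathcomp Require Import all_boot all_order all_algebra.
From mathcomp Require Import finmap.
From mathcomp Require Import all_classical all_reals all_analysis.
Set Implicit Arguments.
Unset Strict Implicit.
Unset Printing Implicit Defensive.
Import Order.TTheory GRing.Theory Num.Theory.
Local Open Scope classical_set_scope.
Local Open Scope ring_scope.

(* Loops are excluded so that every edge has a nonzero direction vector. *)
Record plane_digraph (R : realType) := PlaneDigraph {
  vertex : {fset R * R};
  edges : {set vertex * vertex};
  edges_loopless : forall e, e \in edges -> e.1 != e.2 }.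

Definition edge (R : realType) (G : plane_digraph R) : finType :=
  {e : vertex G * vertex G | e \in edges G}.

Section Walks.
Variables (R : realType) (G : plane_digraph R).
Implicit Types (e f : edge G) (s t : vertex G) (W : seq (edge G)).

Definition etail e : vertex G := (val e).1.
Definition ehead e : vertex G := (val e).2.

Definition direction e : R * R := fsval (ehead e) - fsval (etail e).

Definition dotp (x y : R * R) : R := x.1 * y.1 + x.2 * y.2.

(* The library norm on [R * R] is the sup norm, hence the explicit square
   root. *)
Definition enorm (x : R * R) : R := Num.sqrt (dotp x x).

(* Angle in degrees; 0 means going straight on. *)
Definition angle f e : R :=
  acos (dotp (direction f) (direction e)
        / (enorm (direction f) * enorm (direction e))) * 180 / pi.

Definition consecutive f e : bool := ehead f == etail e.

Definition walk_from s W : bool :=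
  if W is e :: W' then (etail e == s) && path consecutive e W' else false.

Definition walk_between s t W : bool :=
  walk_from s W && (if W is e :: W' then ehead (last e W') == t else false).

Definition last_edge W e : Prop := exists W', W = rcons W' e.

Definition walk_cost (c : edge G -> R) (alpha : R -> R) W : R :=
  if W is e :: _ then
    c e + \sum_(1 <= i < size W)
            (c (nth e W i) + alpha (angle (nth e W i.-1) (nth e W i)))
  else 0.

End Walks.

Definition is_least (R : realType) (A : set R) (x : R) : Prop :=
  A x /\ lbound A x.

Section MinimalAngleBellmanFord.
Variables (R : realType) (G : plane_digraph R) (s : vertex G).
Variables (c : edge G -> R) (alpha : R -> R).
(* [order] is the order in which every iteration goes through the edges;
   [tie] chooses one among several minimizing edges. *)
Variables (order : seq (edge G)) (tie : {set edge G} -> edge G).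

(* The pair [(D, T)]. *)
Definition state : Type := ((edge G -> \bar R) * (edge G -> edge G))%type.

Definition init_state : state :=
  (fun e => if etail e == s then (c e)%:E else +oo%E, fun e => e).

Definition candidate (D : edge G -> \bar R) (e f : edge G) : \bar R :=
  (D f + (c e)%:E + (alpha (angle f e))%:E)%E.

Definition best_candidate (D : edge G -> \bar R) (e : edge G) : \bar R :=
  \big[Order.min/+oo%E]_(f : edge G | consecutive f e) candidate D e f.

Definition minimizers (D : edge G -> \bar R) (e : edge G) : {set edge G} :=
  [set f | consecutive f e & candidate D e f == best_candidate D e]%SET.

Definition update (st : state) (e : edge G) : state :=
  let: (D, T) := st in
  (fun g => if g == e then Order.min (D e) (best_candidate D e) else D g,
   fun g => if (g == e) && (best_candidate D e < D e)%E
            then tie (minimizers D e) else T g).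

(* In place: later edges of the same iteration see the updated values. *)
Definition iteration (st : state) : state := foldl update st order.

Definition bellman_ford (p : nat) : state := iter p iteration init_state.

End MinimalAngleBellmanFord.

(* Main.v *)
Require Import Defs.
From mathcomp Require Import all_boot all_order all_algebra.
From mathcomp Require Import finmap.
From mathcomp Require Import all_classical all_reals all_analysis.
Set Implicit Arguments.
Unset Strict Implicit.
Unset Printing Implicit Defensive.
Import Order.TTheory GRing.Theory Num.Theory.
Local Open Scope classical_set_scope.
Local Open Scope ring_scope.

(** An estimate [D e] is trapped between two bounds.

    From below, it is never smaller than an optimum: every finite value ever
    stored in [D e] is the cost of an actual walk from the source ending with
    [e], because a candidate [D f + c e + alpha (angle f e)] is the cost of
    the walk behind [D f] extended by [e], and taking minima creates no new
    values ([bellman_ford_attained]).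

    From above, after [k] iterations it is at most the cost of every walk from
    the source with at most [k + 1] edges ending with [e]
    ([bellman_ford_le_walk_cost]): if the walk ends with [f] and [e], the
    estimate of [f] was already good enough before the last iteration, and
    that iteration relaxes [e] through [f].  Updating in place does no harm,
    since estimates only decrease: when [e] is processed, the estimate of [f]
    is at most what it was at the beginning of the iteration
    ([foldl_update_le_candidate]).

    Both bounds rest on the cost of a walk depending on the past through its
    last edge only ([walk_cost_rcons]).  That is why the estimates are attached
    to edges and not to vertices: the angle cost makes the vertex version of
    the principle of optimality fail. *)

Section Bounds.
Variables (R : realType) (G : plane_digraph R) (s : vertex G).
Variables (c : edge G -> R) (alpha : R -> R).
Variables (order : seq (edge G)) (tie : {set edge G} -> edge G).
Implicit Types (e f g : edge G) (W : seq (edge G)) (st : state G).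

Local Notation cost := (walk_cost c alpha).
Local Notation upd := (update c alpha tie).

Lemma walk_from_rcons W f e :
  walk_from s (rcons (rcons W f) e)
    = walk_from s (rcons W f) && consecutive f e.
Proof.
by case: W => [|a W] /=; rewrite ?rcons_path ?last_rcons /= ?andbT ?andbA.
Qed.

Lemma walk_cost_rcons W f e :
  cost (rcons (rcons W f) e)
    = cost (rcons W f) + (c e + alpha (angle f e)).
Proof.
have nthE (a : edge G) : nth a (rcons (rcons W f) e) (size W).+1 = e.
  by rewrite nth_rcons size_rcons ltnn eqxx.
have nthf (a : edge G) : nth a (rcons (rcons W f) e) (size W) = f.
  by rewrite nth_rcons size_rcons ltnSn nth_rcons ltnn eqxx.
have [a [W' defW]] : exists a W', rcons W f = a :: W'.
  by case: (W) => [|a W']; [exists f, [::] | exists a, (rcons W' f)].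
have defWe : rcons (rcons W f) e = a :: rcons W' e by rewrite defW.
have sizeW : size W' = size W.
  by have := congr1 size defW; rewrite size_rcons => -[].
rewrite /walk_cost defWe defW -defWe 2!size_rcons big_nat_recr //=.
rewrite sizeW nthE nthf addrA; congr (_ + _ + _).
apply: eq_big_nat => i /andP[i_gt0 i_lt].
have nth_old j : (j < (size W).+1)%N ->
    nth a (rcons (rcons W f) e) j = nth a (a :: W') j.
  by move=> j_lt; rewrite nth_rcons size_rcons j_lt defW.
by rewrite !nth_old // (leq_ltn_trans (leq_pred i)).
Qed.

(** The alternative [+oo] keeps the property stable under the minimum over an
    empty set of predecessors. *)
Definition attained e (x : \bar R) : Prop :=
  x = +oo%E \/
  exists W, [/\ walk_from s W, last_edge W e & x = (cost W)%:E].

Lemma attained_min e x y :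
  attained e x -> attained e y -> attained e (Order.min x y).
Proof. by rewrite /Order.min; case: ifP. Qed.

Lemma attained_candidate (D : edge G -> \bar R) e f :
  attained f (D f) -> consecutive f e -> attained e (candidate c alpha D e f).
Proof.
rewrite /candidate => -[->|[W [sW [W' defW] ->]]] fe; first by left.
right; exists (rcons W e); split; last 1 first.
- by rewrite defW walk_cost_rcons !EFinD addeA.
- by rewrite defW walk_from_rcons -defW sW.
- by exists W.
Qed.

Lemma attained_update st e :
  (forall g, attained g (st.1 g)) -> forall g, attained g ((upd st e).1 g).
Proof.
case: st => D T /= attD g; case: eqP => [->|_] //.
apply: attained_min => //; rewrite /best_candidate.
elim/big_ind: _ => [|x y|f fe]; first by left.
- exact: attained_min.
- exact: attained_candidate.
Qed.

(** No estimate undercuts the least cost of a walk. *)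
Lemma bellman_ford_attained p e :
  attained e ((bellman_ford s c alpha order tie p).1 e).
Proof.
have att_foldl (l : seq (edge G)) st : (forall g, attained g (st.1 g)) ->
    forall g, attained g ((foldl upd st l).1 g).
  by elim: l st => //= a l IHl st /(attained_update a)/IHl.
elim: p e => [|p IHp] e /=; last exact: att_foldl.
case: eqP => [es|_]; last by left.
right; exists [:: e]; split; first by rewrite /= es eqxx.
- by exists [::].
- by rewrite /walk_cost big_geq // addr0.
Qed.

Lemma update_le st e g : ((upd st e).1 g <= st.1 g)%E.
Proof. by case: st => D T /=; case: eqP => // ->; rewrite ge_min lexx. Qed.

Lemma foldl_update_le (l : seq (edge G)) st g :
  ((foldl upd st l).1 g <= st.1 g)%E.
Proof.
elim: l st => //= a l IHl st.
exact: le_trans (IHl _) (update_le _ _ _).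
Qed.

Lemma update_le_candidate st e f :
  consecutive f e -> ((upd st e).1 e <= candidate c alpha st.1 e f)%E.
Proof.
case: st => D T /= fe; rewrite eqxx ge_min.
by apply/orP; right; exact: bigmin_le_cond.
Qed.

Lemma le_candidate (D D' : edge G -> \bar R) e f :
  (D f <= D' f)%E -> (candidate c alpha D e f <= candidate c alpha D' e f)%E.
Proof. by move=> DD'; rewrite /candidate !leeD2r. Qed.

(** A pass over the edges relaxes [e] at least as well as if the estimate of
    [f] were still the one from the beginning of the pass: earlier updates can
    only have lowered it, and later ones can only lower that of [e]. *)
Lemma foldl_update_le_candidate (l : seq (edge G)) st e f :
  e \in l -> consecutive f e ->
  ((foldl upd st l).1 e <= candidate c alpha st.1 e f)%E.
Proof.
move=> + fe; elim: l st => //= a l IHl st; rewrite inE.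
case: eqP => [<- _|_ /= el].
  exact: le_trans (foldl_update_le _ _ _) (update_le_candidate _ fe).
exact: le_trans (IHl _ el) (le_candidate _ (update_le _ _ _)).
Qed.

(** One edge comes for free: the initial estimates already account for the
    walks that consist of a single edge. *)
Lemma bellman_ford_le_walk_cost p W e :
  (forall g, g \in order) ->
  walk_from s (rcons W e) -> (size W <= p)%N ->
  ((bellman_ford s c alpha order tie p).1 e <= (cost (rcons W e))%:E)%E.
Proof.
move=> order_all.
elim: p W e => [|p IHp] W e; case/lastP: W => [|W f].
- move=> /= /andP[-> _] _.
  by rewrite /walk_cost big_geq // addr0.
- by rewrite size_rcons.
- move=> se _; apply: le_trans (foldl_update_le _ _ _) _.
  exact: (IHp [::]).
rewrite size_rcons ltnS walk_from_rcons => /andP[sWf fe] Wp.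
apply: le_trans (foldl_update_le_candidate _ (order_all e) fe) _.
rewrite walk_cost_rcons !EFinD addeA.
by rewrite /candidate !leeD2r //; exact: IHp.
Qed.

Lemma walk_from_between W e :
  walk_from s W -> last_edge W e -> walk_between s (ehead e) W.
Proof.
move=> + [W' defW]; subst W; rewrite /walk_between => -> /=.
by case: W' => [|a W'] /=; rewrite ?last_rcons.
Qed.

End Bounds.

Theorem theorem1 (R : realType) (G : plane_digraph R) (s : vertex G)
    (c : edge G -> R) (alpha : R -> R)
    (alpha_ge0 : forall x : R, 0 <= x <= 180 -> 0 <= alpha x)
    (p : nat) (p_ge1 : (1 <= p)%N)
    (order : seq (edge G)) (order_uniq : uniq order)
    (order_all : forall e : edge G, e \in order)
    (tie : {set edge G} -> edge G)
    (tie_in : forall (A : {set edge G}) (e : edge G), e \in A -> tie A \in A)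
    (t : vertex G) (et : edge G) (et_enters_t : ehead et = t)
    (P : seq (edge G))
    (P_walk : walk_between s t P) (P_last : last_edge P et)
    (P_size : (size P <= p)%N)
    (P_least : forall W : seq (edge G), walk_between s t W -> last_edge W et ->
       walk_cost c alpha P <= walk_cost c alpha W) :
  (bellman_ford s c alpha order tie p).1 et = (walk_cost c alpha P)%:E /\
  is_least [set walk_cost c alpha W | W in
              [set W : seq (edge G) | walk_from s W /\ last_edge W et]]
           (walk_cost c alpha P).
Proof.
have sP : walk_from s P by case/andP: P_walk.
(* Every walk ending with [et] ends at [t], so [P] is also least among the
   walks whose final vertex is not prescribed. *)
have P_min W : walk_from s W -> last_edge W et ->
    walk_cost c alpha P <= walk_cost c alpha W.
  move=> sW Wet; apply: P_least => //.
  by rewrite -et_enters_t; exact: walk_from_between.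
split; last first.
  split; first by exists P.
  by move=> _ [W [sW Wet] <-]; exact: P_min.
have D_le : ((bellman_ford s c alpha order tie p).1 et
              <= (walk_cost c alpha P)%:E)%E.
  case: P_last => P' defP; move: sP P_size; rewrite defP size_rcons => sP' P'p.
  by apply: bellman_ford_le_walk_cost => //; exact: ltnW.
have [Doo|[W [sW Wet DW]]] := bellman_ford_attained s c alpha order tie p et.
  by rewrite Doo in D_le.
by apply/le_anti; rewrite D_le DW lee_fin P_min.
Qed.
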